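(* Let $(U^{(n)},M^{(n)})_{n\ge 0}$, with $U^{(n)}=(U^{(n)}_1,U^{(n)}_2)$ and $M^{(n)}=(M^{(n)}_1,M^{(n)}_2)$, be a numerical solution produced by Scheme 1 (as defined in the context) under the discrete periodic boundary conditions. Then for each $n=1,2,\ldots$ and each component $i\in\{1,2\}$, $$\sum_{j=0}^{\mathcal J-1}\sum_{k=0}^{\mathcal K-1} U^{(n)}_{i;k,j}\,\Delta x\,\Delta y=\sum_{j=0}^{\mathcal J-1}\sum_{k=0}^{\mathcal K-1} U^{(0)}_{i;k,j}\,\Delta x\,\Delta y ,$$ and $$\sum_{j=0}^{\mathcal J-1}\sum_{k=0}^{\mathcal K-1} H^{(n)}_{k,j}\,\Delta x\,\Delta y=\sum_{j=0}^{\mathcal J-1}\sum_{k=0}^{\mathcal K-1} H^{(0)}_{k,j}\,\Delta x\,\Delta y ,$$ where $H^{(n)}_{k,j}=\tfrac12\big(M^{(n)}_{1;k,j}U^{(n)}_{1;k,j}+M^{(n)}_{2;k,j}U^{(n)}_{2;k,j}\big)$.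
   Context: Fix $\alpha>0$, a time step $\Delta t>0$, and integers $\mathcal K,\mathcal J\ge 1$; put $\Delta x=2/\mathcal K$, $\Delta y=2/\mathcal J$. Grid functions are real arrays $f=(f_{k,j})$, $0\le k\le\mathcal K-1$, $0\le j\le\mathcal J-1$, where $k$ is the index in the $x$ direction and $j$ the index in the $y$ direction; they are extended periodically ($k$ modulo $\mathcal K$, $j$ modulo $\mathcal J$; these are the discrete periodic boundary conditions). Products of grid functions are entrywise. The discrete operators are $$\delta_k^{<1>}f_{k,j}=\frac{f_{k+1,j}-f_{k-1,j}}{2\Delta x},\quad \delta_j^{<1>}f_{k,j}=\frac{f_{k,j+1}-f_{k,j-1}}{2\Delta y},$$ $$\delta_{kk}^{<2>}f_{k,j}=\frac{f_{k+1,j}-2f_{k,j}+f_{k-1,j}}{\Delta x^2},\quad \delta_{jj}^{<2>}f_{k,j}=\frac{f_{k,j+1}-2f_{k,j}+f_{k,j-1}}{\Delta y^2}.$$ At each time level $n$ the discrete velocity $U^{(n)}_i$ and momentum $M^{(n)}_i$ ($i=1,2$) are grid functions related by $M^{(n)}_{i;k,j}=(1-\alpha^2\delta_{kk}^{<2>}-\alpha^2\delta_{jj}^{<2>})U^{(n)}_{i;k,j}$. Abbreviate $M_i^{(n+\frac12)}=\frac12(M_i^{(n+1)}+M_i^{(n)})$ and $U_i^{(n+\frac12)}=\frac12(U_i^{(n+1)}+U_i^{(n)})$. Scheme 1 is the system, for all $n\ge0$ and all $k,j$ (all $U,M$ on the right-hand side are taken at time level $n+\frac12$), $$\frac{M^{(n+1)}_{1;k,j}-M^{(n)}_{1;k,j}}{\Delta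 t}=-\Big[M_{1;k,j}\,\delta_k^{<1>}U_{1;k,j}+M_{2;k,j}\,\delta_k^{<1>}U_{2;k,j}+\delta_k^{<1>}(M_{1;k,j}U_{1;k,j})+\delta_j^{<1>}(M_{1;k,j}U_{2;k,j})\Big],$$ $$\frac{M^{(n+1)}_{2;k,j}-M^{(n)}_{2;k,j}}{\Delta t}=-\Big[M_{1;k,j}\,\delta_j^{<1>}U_{1;k,j}+M_{2;k,j}\,\delta_j^{<1>}U_{2;k,j}+\delta_k^{<1>}(M_{2;k,j}U_{1;k,j})+\delta_j^{<1>}(M_{2;k,j}U_{2;k,j})\Big].$$ *)

(* Defs.v *)
From HB Require Import structures.
From mathcomp Require Import all_boot all_order all_algebra.
From mathcomp Require Import reals.

Set Implicit Arguments.
Unset Strict Implicit.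
Unset Printing Implicit Defensive.

Import Order.TTheory GRing.Theory Num.Theory.
Local Open Scope ring_scope.

(* [f k j]: [k] is the index in the x direction, [j] the index in the y
   direction. Periodicity is built into the index arithmetic: [ordS] and
   [ord_pred] are the successor and the predecessor modulo the size of the
   ordinal type, and are defined for every size >= 1. *)
Definition grid (R : realType) (K J : nat) := 'I_K -> 'I_J -> R.

(* The spatial period is 2 in each direction. *)
Definition mesh (R : realType) (N : nat) : R := 2 / N%:R.

Section Operators.
Variables (R : realType) (K J : nat).
Implicit Types f g : grid R K J.

Definition dk1 f : grid R K J := fun k j =>
  (f (ordS k) j - f (ord_pred k) j) / (2 * mesh R K).

Definition dj1 f : grid R K J := fun k j =>
  (f k (ordS j) - f k (ord_pred j)) / (2 * mesh R J).

Definition dkk2 f : grid R K J := fun k j =>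
  (f (ordS k) j - 2 * f k j + f (ord_pred k) j) / mesh R K ^+ 2.

Definition djj2 f : grid R K J := fun k j =>
  (f k (ordS j) - 2 * f k j + f k (ord_pred j)) / mesh R J ^+ 2.

Definition gmul f g : grid R K J := fun k j => f k j * g k j.

Definition gavg f g : grid R K J := fun k j => 2^-1 * (f k j + g k j).

End Operators.

(* The two components of the velocity and of the momentum are indexed by
   ['I_2]; [c1] and [c2] stand for i = 1 and i = 2. *)
Definition c1 : 'I_2 := ord0.
Definition c2 : 'I_2 := ord_max.

Section Scheme.
Variables (R : realType) (K J : nat) (alpha dt : R).

(* [U n i k j] is the value at time level [n] of component [i] at the grid
   point [(k, j)], and likewise for [M]. *)
Implicit Types U M : nat -> 'I_2 -> grid R K J.

Definition half_level U (n : nat) (i : 'I_2) : grid R K J :=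
  gavg (U n.+1 i) (U n i).

Definition momentum_relation U M := forall n i k j,
  M n i k j =
    U n i k j - alpha ^+ 2 * dkk2 (U n i) k j - alpha ^+ 2 * djj2 (U n i) k j.

Definition scheme1_eq1 U M := forall n k j,
  let Uh := half_level U n in let Mh := half_level M n in
  (M n.+1 c1 k j - M n c1 k j) / dt =
  - (Mh c1 k j * dk1 (Uh c1) k j + Mh c2 k j * dk1 (Uh c2) k j
     + dk1 (gmul (Mh c1) (Uh c1)) k j + dj1 (gmul (Mh c1) (Uh c2)) k j).

Definition scheme1_eq2 U M := forall n k j,
  let Uh := half_level U n in let Mh := half_level M n in
  (M n.+1 c2 k j - M n c2 k j) / dt =
  - (Mh c1 k j * dj1 (Uh c1) k j + Mh c2 k j * dj1 (Uh c2) k j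
     + dk1 (gmul (Mh c2) (Uh c1)) k j + dj1 (gmul (Mh c2) (Uh c2)) k j).

Definition scheme1 U M :=
  [/\ momentum_relation U M, scheme1_eq1 U M & scheme1_eq2 U M].

Definition hamiltonian_density U M (n : nat) : grid R K J := fun k j =>
  2^-1 * (M n c1 k j * U n c1 k j + M n c2 k j * U n c2 k j).

End Scheme.

(* Main.v *)
(** Write L = 1 - alpha^2 dkk2 - alpha^2 djj2, so that M = L U. By periodic
    summation by parts, L is symmetric and the centred differences are
    antisymmetric; moreover they commute with L, so L u is orthogonal to dk1 u
    and to dj1 u. Summing the scheme thus kills the nonconservative terms, which
    gives conservation of the total momentum, and L preserves the total sum.
    For the energy, symmetry of L turns the increment of the sum of M_i U_i into
    twice the sum of (M_i^(n+1) - M_i^(n)) U_i^(n+1/2); after inserting the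
    scheme, the eight terms pair off into four discrete product rules
    f dg + df g, each of which sums to zero. *)

Require Import Defs.
From HB Require Import structures.
From mathcomp Require Import all_boot all_order all_algebra.
From mathcomp Require Import reals ring.

Set Implicit Arguments.
Unset Strict Implicit.
Unset Printing Implicit Defensive.

Import Order.TTheory GRing.Theory Num.Theory.
Local Open Scope ring_scope.

Definition gsum (R : realType) (K J : nat) (f : grid R K J) : R :=
  \sum_(j < J) \sum_(k < K) f k j.

Section GridSums.
Variables (R : realType) (K J : nat).
Implicit Types f g : grid R K J.

Lemma eq_gsum f g : (forall k j, f k j = g k j) -> gsum f = gsum g.
Proof. by move=> fg; apply: eq_bigr => j _; apply: eq_bigr => k _. Qed.

Lemma gsumD f g : gsum (fun k j => f k j + g k j) = gsum f + gsum g.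
Proof.
by rewrite /gsum -big_split; apply: eq_bigr => j _; rewrite -big_split.
Qed.

Lemma gsumZ (a : R) f : gsum (fun k j => a * f k j) = a * gsum f.
Proof. by rewrite /gsum mulr_sumr; apply: eq_bigr => j _; rewrite mulr_sumr. Qed.

Lemma gsumB f g : gsum (fun k j => f k j - g k j) = gsum f - gsum g.
Proof.
rewrite -[- gsum g]mulN1r -gsumZ -gsumD.
by apply: eq_gsum => k j; rewrite mulN1r.
Qed.

(** [ordS] permutes ['I_K], so reindexing the inner sum cancels it with no boundary term. *)
Lemma gsum_telescope f (F : grid R K J) :
  (forall k j, f k j = F (ordS k) j - F k j) -> gsum f = 0.
Proof.
move=> fF; rewrite (eq_gsum fF) gsumB; apply/eqP; rewrite subr_eq0; apply/eqP.
apply: eq_bigr => j _; rewrite [RHS](reindex_inj (@ordS_inj K)); exact: eq_bigr.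
Qed.

End GridSums.

(** Transposing the grid turns [dj1] and [djj2] into [dk1] and [dkk2] by conversion, so only the x
    direction is computed. *)
Lemma gsum_swap (R : realType) (K J : nat) (f : grid R K J) :
  gsum f = gsum ((fun j k => f k j) : grid R J K).
Proof. exact: exchange_big. Qed.

Section SummationByParts.
Variables (R : realType).

Lemma gsum_dk1 K J (f : grid R K J) : gsum (dk1 f) = 0.
Proof.
apply: (@gsum_telescope _ _ _ _
  (fun k j => (f k j + f (ord_pred k) j) / (2 * mesh R K))) => k j.
by rewrite /dk1 ordSK; ring.
Qed.

Lemma gsum_dj1 K J (f : grid R K J) : gsum (dj1 f) = 0.
Proof. by rewrite gsum_swap; exact: (gsum_dk1 (fun j k => f k j)). Qed.

Lemma gsum_dkk2 K J (f : grid R K J) : gsum (dkk2 f) = 0.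
Proof.
apply: (@gsum_telescope _ _ _ _
  (fun k j => (f k j - f (ord_pred k) j) / mesh R K ^+ 2)) => k j.
by rewrite /dkk2 ordSK; ring.
Qed.

Lemma gsum_djj2 K J (f : grid R K J) : gsum (djj2 f) = 0.
Proof. by rewrite gsum_swap; exact: (gsum_dkk2 (fun j k => f k j)). Qed.

Lemma gsum_dk1_parts K J (f g : grid R K J) :
  gsum (fun k j => f k j * dk1 g k j + dk1 f k j * g k j) = 0.
Proof.
(* The two products f_k g_k cancel nothing here: only neighbouring products occur, and they regroup
   as a symmetric flux through the edge between k-1 and k. *)
apply: (@gsum_telescope _ _ _ _ (fun k j =>
  (f k j * g (ord_pred k) j + f (ord_pred k) j * g k j) / (2 * mesh R K))).
by move=> k j; rewrite /dk1 ordSK; ring.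
Qed.

Lemma gsum_dj1_parts K J (f g : grid R K J) :
  gsum (fun k j => f k j * dj1 g k j + dj1 f k j * g k j) = 0.
Proof.
rewrite gsum_swap.
exact: (gsum_dk1_parts (fun j k => f k j) (fun j k => g k j)).
Qed.

Lemma gsum_dkk2_sym K J (f g : grid R K J) :
  gsum (fun k j => f k j * dkk2 g k j - dkk2 f k j * g k j) = 0.
Proof.
(* Discrete Green identity: the flux is the discrete Wronskian of f and g. *)
apply: (@gsum_telescope _ _ _ _ (fun k j =>
  (f (ord_pred k) j * g k j - f k j * g (ord_pred k) j) / mesh R K ^+ 2)).
by move=> k j; rewrite /dkk2 ordSK; ring.
Qed.

Lemma gsum_djj2_sym K J (f g : grid R K J) :
  gsum (fun k j => f k j * djj2 g k j - djj2 f k j * g k j) = 0.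
Proof.
rewrite gsum_swap.
exact: (gsum_dkk2_sym (fun j k => f k j) (fun j k => g k j)).
Qed.

End SummationByParts.

Section Helmholtz.
Variables (R : realType) (alpha : R) (K J : nat).
Implicit Types u v : grid R K J.

Definition helmholtz u : grid R K J := fun k j =>
  u k j - alpha ^+ 2 * dkk2 u k j - alpha ^+ 2 * djj2 u k j.

Lemma gsum_helmholtz u : gsum (helmholtz u) = gsum u.
Proof. by rewrite /helmholtz !gsumB !gsumZ gsum_dkk2 gsum_djj2 mulr0 !subr0. Qed.

Lemma gsum_helmholtz_sym u v :
  gsum (fun k j => u k j * helmholtz v k j - helmholtz u k j * v k j) = 0.
Proof.
rewrite (@eq_gsum _ _ _ _ (fun k j =>
  - alpha ^+ 2 * (u k j * dkk2 v k j - dkk2 u k j * v k j)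
  + - alpha ^+ 2 * (u k j * djj2 v k j - djj2 u k j * v k j))).
  by rewrite gsumD !gsumZ gsum_dkk2_sym gsum_djj2_sym mulr0 addr0.
by move=> k j; rewrite /helmholtz; ring.
Qed.

Lemma helmholtz_dk1 u k j : helmholtz (dk1 u) k j = dk1 (helmholtz u) k j.
Proof. by rewrite /helmholtz /dkk2 /djj2 /dk1 !ordSK !ord_predK; ring. Qed.

Lemma helmholtz_dj1 u k j : helmholtz (dj1 u) k j = dj1 (helmholtz u) k j.
Proof. by rewrite /helmholtz /dkk2 /djj2 /dj1 !ordSK !ord_predK; ring. Qed.

(* An antisymmetric operator commuting with [helmholtz] has
   [<L u, D u> = <u, L D u> = <u, D L u> = - <D u, L u>]. *)
Lemma gsum_helmholtz_orth (D : grid R K J -> grid R K J) u :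
  (forall f g, gsum (fun k j => f k j * D g k j + D f k j * g k j) = 0) ->
  (forall f k j, helmholtz (D f) k j = D (helmholtz f) k j) ->
  gsum (fun k j => helmholtz u k j * D u k j) = 0.
Proof.
move=> antiD commD; set s := gsum _.
suff: 2 * s = 0 by move/eqP; rewrite mulf_eq0 pnatr_eq0 /= => /eqP.
rewrite -gsumZ -[RHS](subr0 0).
rewrite -[X in X - _](antiD u (helmholtz u)).
rewrite -[X in _ - X](gsum_helmholtz_sym u (D u)) -gsumB.
by apply: eq_gsum => k j; rewrite commD; ring.
Qed.

Lemma gsum_helmholtz_dk1 u : gsum (fun k j => helmholtz u k j * dk1 u k j) = 0.
Proof.
exact: gsum_helmholtz_orth (@gsum_dk1_parts R K J) helmholtz_dk1.
Qed.

Lemma gsum_helmholtz_dj1 u : gsum (fun k j => helmholtz u k j * dj1 u k j) = 0.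
Proof.
exact: gsum_helmholtz_orth (@gsum_dj1_parts R K J) helmholtz_dj1.
Qed.

End Helmholtz.

Lemma ord2_cases (P : 'I_2 -> Prop) : P c1 -> P c2 -> forall i, P i.
Proof.
move=> P1 P2 [[|[|//]] lti].
  by rewrite (_ : Ordinal lti = c1) //; apply: val_inj.
by rewrite (_ : Ordinal lti = c2) //; apply: val_inj.
Qed.

Section Conservation.
Variables (R : realType) (K J : nat) (alpha dt : R).
Variables (U M : nat -> 'I_2 -> grid R K J).
Hypotheses (dt0 : dt != 0) (UM : scheme1 alpha dt U M).

Local Notation Uh := (half_level U).
Local Notation Mh := (half_level M).

Lemma momentumE n i k j : M n i k j = helmholtz alpha (U n i) k j.
Proof. by case: UM. Qed.

(** Linearity of [helmholtz] carries the relation to the time average, where the scheme evaluates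
    its right-hand side. *)
Lemma half_momentumE n i k j : Mh n i k j = helmholtz alpha (Uh n i) k j.
Proof.
rewrite /half_level {1}/gavg !momentumE /helmholtz /dkk2 /djj2 /gavg; ring.
Qed.

Lemma scheme_increment1 n k j : M n.+1 c1 k j - M n c1 k j =
  - dt * (Mh n c1 k j * dk1 (Uh n c1) k j + Mh n c2 k j * dk1 (Uh n c2) k j
    + dk1 (gmul (Mh n c1) (Uh n c1)) k j
    + dj1 (gmul (Mh n c1) (Uh n c2)) k j).
Proof. by case: UM => _ /(_ n k j) /= E _; rewrite mulNr -mulrN -E mulrC divfK. Qed.

Lemma scheme_increment2 n k j : M n.+1 c2 k j - M n c2 k j =
  - dt * (Mh n c1 k j * dj1 (Uh n c1) k j + Mh n c2 k j * dj1 (Uh n c2) k j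
    + dk1 (gmul (Mh n c2) (Uh n c1)) k j
    + dj1 (gmul (Mh n c2) (Uh n c2)) k j).
Proof. by case: UM => _ _ /(_ n k j) /= E; rewrite mulNr -mulrN -E mulrC divfK. Qed.

Lemma gsum_half_dk1 n i : gsum (fun k j => Mh n i k j * dk1 (Uh n i) k j) = 0.
Proof.
rewrite -[RHS](gsum_helmholtz_dk1 alpha (Uh n i)).
by apply: eq_gsum => k j; rewrite half_momentumE.
Qed.

Lemma gsum_half_dj1 n i : gsum (fun k j => Mh n i k j * dj1 (Uh n i) k j) = 0.
Proof.
rewrite -[RHS](gsum_helmholtz_dj1 alpha (Uh n i)).
by apply: eq_gsum => k j; rewrite half_momentumE.
Qed.

Lemma gsum_velocity_step n i : gsum (U n.+1 i) = gsum (U n i).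
Proof.
(* The scheme evolves the momentum, so the velocity sums are first traded for momentum sums. *)
have E m l : gsum (U m l) = gsum (M m l).
  by rewrite -(gsum_helmholtz alpha); apply/esym/eq_gsum/momentumE.
rewrite !E; apply/eqP; rewrite -subr_eq0 -gsumB; apply/eqP.
elim/ord2_cases: i.
  by rewrite (eq_gsum (scheme_increment1 n)) gsumZ !gsumD !gsum_half_dk1
    gsum_dk1 gsum_dj1 !addr0 mulr0.
by rewrite (eq_gsum (scheme_increment2 n)) gsumZ !gsumD !gsum_half_dj1
  gsum_dk1 gsum_dj1 !addr0 mulr0.
Qed.

Lemma gsum_momentum_sym m n i :
  gsum (fun k j => U m i k j * M n i k j - M m i k j * U n i k j) = 0.
Proof.
rewrite -[RHS](gsum_helmholtz_sym alpha (U m i) (U n i)).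
by apply: eq_gsum => k j; rewrite !momentumE.
Qed.

Lemma gsum_hamiltonian_step n :
  gsum (hamiltonian_density U M n.+1) = gsum (hamiltonian_density U M n).
Proof.
apply/eqP; rewrite -subr_eq0 -gsumB; apply/eqP.
(* The flux of M_i U_l, tested with U_i in equation i, is paired with the nonconservative term M_i
   dk1 U_i, tested with U_l in equation l. *)
pose Pk i l k j :=
  Uh n i k j * dk1 (gmul (Mh n i) (Uh n l)) k j
  + dk1 (Uh n i) k j * gmul (Mh n i) (Uh n l) k j.
pose Pj i l k j :=
  Uh n i k j * dj1 (gmul (Mh n i) (Uh n l)) k j
  + dj1 (Uh n i) k j * gmul (Mh n i) (Uh n l) k j.
(* Cross terms between the two time levels, of zero sum by symmetry of [helmholtz]. *)
pose S i k j :=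
  U n.+1 i k j * M n i k j - M n.+1 i k j * U n i k j.
rewrite (@eq_gsum _ _ _ _ (fun k j =>
  - dt * (Pk c1 c1 k j + Pk c2 c1 k j + Pj c1 c2 k j + Pj c2 c2 k j)
  + 2^-1 * (S c1 k j + S c2 k j))).
  have Pk0 i l : gsum (Pk i l) = 0 by exact: gsum_dk1_parts.
  have Pj0 i l : gsum (Pj i l) = 0 by exact: gsum_dj1_parts.
  have S0 i : gsum (S i) = 0 by exact: gsum_momentum_sym.
  (* Made opaque so that [gsumD] splits down to these terms and no further. *)
  clearbody Pk Pj S.
  by rewrite gsumD !gsumZ !gsumD !Pk0 !Pj0 !S0 !addr0 !mulr0 addr0.
move=> k j.
(* Midpoint identity, with primes for level n+1: (M'U' - MU)/2 = (U' + U)(M' - M)/2 + (U'M -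
   M'U)/2. *)
transitivity (Uh n c1 k j * (M n.+1 c1 k j - M n c1 k j)
  + Uh n c2 k j * (M n.+1 c2 k j - M n c2 k j)
  + 2^-1 * (S c1 k j + S c2 k j)).
  by rewrite /hamiltonian_density /S /half_level /gavg; field.
rewrite scheme_increment1 scheme_increment2 /Pk /Pj /gmul.
by ring.
Qed.

End Conservation.

Theorem theorem1 (R : realType) (K J : nat) (alpha dt : R)
    (U M : nat -> 'I_2 -> grid R K J)
    (hK : (1 <= K)%N) (hJ : (1 <= J)%N) (halpha : 0 < alpha) (hdt : 0 < dt)
    (hUM : scheme1 alpha dt U M) :
  forall n : nat, (1 <= n)%N ->
    (forall i : 'I_2,
       \sum_(j < J) \sum_(k < K) U n i k j * mesh R K * mesh R J =
       \sum_(j < J) \sum_(k < K) U 0%N i k j * mesh R K * mesh R J) /\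
    \sum_(j < J) \sum_(k < K)
       hamiltonian_density U M n k j * mesh R K * mesh R J =
    \sum_(j < J) \sum_(k < K)
       hamiltonian_density U M 0%N k j * mesh R K * mesh R J.
Proof.
(* The cell area is constant and factors out, leaving an induction on n over the one-step laws. *)
have gsum_cell (f : grid R K J) :
    \sum_(j < J) \sum_(k < K) f k j * mesh R K * mesh R J =
    gsum f * mesh R K * mesh R J.
  rewrite -mulrA /gsum mulr_suml; apply: eq_bigr => j _.
  by rewrite mulr_suml; apply: eq_bigr => k _; rewrite mulrA.
have dt0 : dt != 0 by rewrite gt_eqF.
move=> n _; split=> [i|]; rewrite !gsum_cell; congr (_ * _ * _).
  by elim: n => // n <-; exact: gsum_velocity_step dt0 hUM n i.
by elim: n => // n <-; exact: gsum_hamiltonian_step dt0 hUM n.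
Qed.
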